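(* Let $b_{1,1}=-b_{2,1}$, $b_{1,2}=-b_{2,2}$ and $g_1=-g_2$ (so that the continuous model fluxes $F_i:=b_{i,1}u_1+b_{i,2}u_2-g_i$ satisfy $F_1+F_2=0$ on $\Gamma\times(0,t_f]$). Then on each coupling window $\tilde n$ the fluxes $F_1^{\tilde n},F_2^{\tilde n}$ computed in the multirate DGiT framework, i.e. determined from the states $u_i^n$ by the trace equations (T) and the flux equations (F) of the context, satisfy $$F_1^{\tilde n}+F_2^{\tilde n}=0$$ if $r_1=r_2$. Otherwise, they satisfy $$\int_{I^{\tilde n}}\left(F_1^{\tilde n}+F_2^{\tilde n},\lambda^{\tilde n}\right)_\Gamma dt=0\qquad\forall\,\lambda^{\tilde n}\in\mathcal V^{\tilde n}(s),$$ where $s=\min\{r_1,r_2\}$.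
   Context: Spatial setting. Let $d\in\{2,3\}$, $\Gamma=(0,1)^{d-1}\times\{0\}\subset\mathbb R^d$, $\Omega_1=(0,1)^{d-1}\times(0,1)$, $\Omega_2=(0,1)^{d-1}\times(-1,0)$, and $\Gamma_i=\partial\Omega_i\setminus\Gamma$. For $i=1,2$ let $\tau_i$ be a conforming regular mesh of $\Omega_i$ (triangles or quadrilaterals if $d=2$, tetrahedra or parallelepipeds if $d=3$); the two meshes coincide on $\Gamma$ and induce a partition $\tau_\Gamma$ of $\Gamma$. For a fixed integer $k\ge1$, $U_i$ is the space of continuous functions on $\overline{\Omega_i}$ that are polynomials in $\mathbb P_k$ on each mesh cell (tensor-product polynomials of order $k$ in each coordinate on quadrilaterals/parallelepipeds) and vanish on $\Gamma_i$; $U_\Gamma$ is the analogous space of continuous piecewise $\mathbb P_k$ functions on $\overline\Gamma$ with respect to $\tau_\Gamma$ vanishing on $\partial\Gamma$ (the trace space of $U_1$ and of $U_2$). Let $\{\phi_{i,j}\}_{j=1}^{d_{\Omega_i}}$ and $\{\mu_j\}_{j=1}^{d_\Gamma}$ be nodal bases of $U_i$ and $U_\Gamma$. Write $(\mu,\lambda)_\Gamma=\int_\Gamma\mu\lambda\,d\Gamma$; functions in $U_i$ are replaced by their traces in $(\cdot,\cdot)_\Gamma$. The $b_{i,j}$ ($i,j=1,2$) are real constants, and $g_i:\Gamma\times(0,t_f]\to\mathbb R$ are given interfacial forcings (such that the integrals below make sense). Time setting. Let $t_f>0$, $N\in\mathbb N$, $\Delta t=t_f/N$, $t^{\tilde n}=\tilde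 n\Delta t$, and $I^{\tilde n}=(t^{\tilde n-1},t^{\tilde n})$, $1\le\tilde n\le N$; $[t^{\tilde n-1},t^{\tilde n}]$ is coupling window $\tilde n$. For $i=1,2$ let $M_i\in\mathbb N$, $\Delta t_i=\Delta t/M_i$; on window $\tilde n$ set $t_i^n=t^{\tilde n-1}+n\Delta t_i$ and $I_i^n=(t_i^{n-1},t_i^n)$. For integers $q\ge 0$, $r\ge0$, $\mathcal U_i^n(q)$ is the space of functions $\sum_{j}v_j(t)\phi_{i,j}(x)$ with $v_j\in\mathbb P_q(I_i^n)$, and $\mathcal V^{\tilde n}(r)$ is the space of functions $\sum_j\lambda_j(t)\mu_j(x)$ with $\lambda_j\in\mathbb P_r(I^{\tilde n})$. Multirate coupling. Let $r_1,r_2\ge0$ be integers. On window $\tilde n$, with the states $u_i^n\in\mathcal U_i^n(q)$, $1\le n\le M_i$, $i=1,2$, produced by the substepping methods, the auxiliary traces $u_{\Gamma,i}^{\tilde n}\in\mathcal V^{\tilde n}(r_i)$ and the fluxes $F_i^{\tilde n}\in\mathcal V^{\tilde n}(r_i)$ are defined, for $i=1,2$, by (T) $\displaystyle\int_{I^{\tilde n}}(u_{\Gamma,i}^{\tilde n},\lambda)_\Gamma\,dt=\sum_{n=1}^{M_i}\int_{I_i^n}(u_i^n,\lambda)_\Gamma\,dt\quad\forall\lambda\in\mathcal V^{\tilde n}(r_i),$ (F) $\displaystyle\int_{I^{\tilde n}}(F_i^{\tilde n},\lambda)_\Gamma\,dt=\int_{I^{\tilde n}}(b_{i,1}u_{\Gamma,1}^{\tilde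 n}+b_{i,2}u_{\Gamma,2}^{\tilde n}-g_i,\lambda)_\Gamma\,dt\quad\forall\lambda\in\mathcal V^{\tilde n}(r_i).$ *)

(* Defs.v *)
From HB Require Import structures.
From mathcomp Require Import all_boot all_order all_algebra.
From mathcomp Require Import all_classical all_reals all_analysis.
From mathcomp Require mpoly.

Set Implicit Arguments.
Unset Strict Implicit.
Unset Printing Implicit Defensive.

Import Order.TTheory GRing.Theory Num.Theory numFieldNormedType.Exports.

Local Open Scope classical_set_scope.
Local Open Scope ring_scope.

(* Functions on a subset of R^d (or of R x R^d) are represented by total       *)
(* functions; only their values on that subset are ever constrained or used.   *)

Section Geometry.
Context {R : realType} {d : nat}.
Implicit Types (x : 'rV[R]_d) (i : 'I_2).

(* The index i : 'I_2 stands for the subdomain i.+1: ord0 is the one above     *)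
(* the interface and ord_max the one below.  The last coordinate of R^d is     *)
(* the j : 'I_d with j.+1 = d.                                                 *)
Definition Omega i : set 'rV[R]_d :=
  [set x | forall j : 'I_d,
     if (j.+1 < d)%N then 0 < x 0 j < 1
     else if i == ord0 then 0 < x 0 j < 1 else -1 < x 0 j < 0].

Definition Gamma : set 'rV[R]_d :=
  [set x | forall j : 'I_d, if (j.+1 < d)%N then 0 < x 0 j < 1 else x 0 j == 0].

Definition boundary_outer i : set 'rV[R]_d :=
  (closure (Omega i) `\` interior (Omega i)) `\` Gamma.

(* The boundary of Gamma relative to the hyperplane containing it.             *)
Definition boundary_Gamma : set 'rV[R]_d := closure Gamma `\` Gamma.

(* The surface measure of Gamma is Lebesgue measure on (0,1)^(d-1), carried    *)
(* over by (y_1, ..., y_(d-1)) |-> (y_1, ..., y_(d-1), 0); entries of s past   *)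
(* its end are 0.  Only d = 2 and d = 3 are meaningful.                        *)
Definition row_of_seq (s : seq R) : 'rV[R]_d := \row_j s`_j.

Definition int_Gamma (f : 'rV[R]_d -> R) : R :=
  match d with
  | 2 => \int[@lebesgue_measure R]_(y in `]0, 1[) f (row_of_seq [:: y : R])
  | 3 => \int[(@lebesgue_measure R \x @lebesgue_measure R)%E]_(y in
             `]0, 1[ `*` `]0, 1[) f (row_of_seq [:: y.1 : R; y.2 : R])
  | _ => 0
  end.

Definition integrable_Gamma (f : 'rV[R]_d -> R) : Prop :=
  match d with
  | 2 => (@lebesgue_measure R).-integrable `]0, 1[
           (fun y => (f (row_of_seq [:: y : R]))%:E)
  | 3 => (@lebesgue_measure R \x @lebesgue_measure R)%E.-integrable
           (`]0, 1[ `*` `]0, 1[)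
           (fun y => (f (row_of_seq [:: y.1 : R; y.2 : R]))%:E)
  | _ => False
  end.

Definition dot_Gamma (f h : 'rV[R]_d -> R) : R :=
  int_Gamma (fun x => f x * h x).

End Geometry.

Section Cells.
Variables (R : realType) (d : nat).

(* n-dimensional cells in R^d, given by their vertices: simplices (segments,   *)
(* triangles, tetrahedra), and images of [0,1]^n under the multilinear map     *)
(* with prescribed values at the corners (segments, quadrilaterals,            *)
(* parallelepipeds), where sigma stands for the corner (sigma i)_i.            *)
Inductive cell (n : nat) : Type :=
  | Simplex of 'I_n.+1 -> 'rV[R]_d
  | Cuboid of {ffun 'I_n -> bool} -> 'rV[R]_d.

Definition unit_cube n : set 'rV[R]_n := [set s | forall i, 0 <= s 0 i <= 1].

Definition cuboid_map n (v : {ffun 'I_n -> bool} -> 'rV[R]_d) (s : 'rV[R]_n) :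
    'rV[R]_d :=
  \sum_(sigma : {ffun 'I_n -> bool})
    (\prod_(i < n) (if sigma i then s 0 i else 1 - s 0 i)) *: v sigma.

Definition simplex_face n (v : 'I_n.+1 -> 'rV[R]_d) (A : {set 'I_n.+1}) :
    set 'rV[R]_d :=
  [set x | exists w : 'I_n.+1 -> R,
     [/\ forall j, 0 <= w j, \sum_j w j = 1,
         forall j, j \notin A -> w j = 0 & x = \sum_j w j *: v j]].

(* a i = Some b fixes the i-th reference coordinate to b.                      *)
Definition cuboid_face n (v : {ffun 'I_n -> bool} -> 'rV[R]_d)
    (a : {ffun 'I_n -> option bool}) : set 'rV[R]_d :=
  [set cuboid_map v s |
    s in [set s | unit_cube s /\ forall i b, a i = Some b -> s 0 i = b%:R]].

Definition is_face n (K : cell n) (e : nat) (S : set 'rV[R]_d) : Prop :=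
  match K with
  | Simplex v => exists2 A : {set 'I_n.+1}, #|A| = e.+1 & S = simplex_face v A
  | Cuboid v => exists2 a : {ffun 'I_n -> option bool},
      #|[set i | a i == None]%SET| = e & S = cuboid_face v a
  end.

Definition cell_set n (K : cell n) : set 'rV[R]_d :=
  match K with
  | Simplex v => simplex_face v [set: 'I_n.+1]%SET
  | Cuboid v => [set cuboid_map v s | s in @unit_cube n]
  end.

(* The rows are the n edges at the corner sigma, each directed from its        *)
(* false end to its true end: the Jacobian matrix of cuboid_map at sigma.      *)
Definition corner_edges n (v : {ffun 'I_n -> bool} -> 'rV[R]_d)
    (sigma : {ffun 'I_n -> bool}) : 'M[R]_(n, d) :=
  \matrix_(i < n) (v [ffun j => (j == i) || sigma j]
                   - v [ffun j => (j != i) && sigma j]).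

Definition parallelotope n (v : {ffun 'I_n -> bool} -> 'rV[R]_d) : Prop :=
  let o : {ffun 'I_n -> bool} := [ffun=> false] in
  row_free (corner_edges v o) /\
  forall sigma : {ffun 'I_n -> bool},
    v sigma = v o + \sum_(i | sigma i) row i (corner_edges v o).

Definition flat_cell n (K : cell n) : Prop :=
  match K with
  | Simplex v =>
      row_free (\matrix_(j < n) (v (lift ord0 j) - v ord0) : 'M[R]_(n, d))
  | Cuboid v => parallelotope v
  end.

(* For d = 2 the Jacobian determinant of cuboid_map is affine in the reference *)
(* coordinates, so this says that it does not vanish on the reference square,  *)
(* i.e. that v is a nondegenerate convex quadrilateral.                        *)
Definition convex_cuboid (v : {ffun 'I_d -> bool} -> 'rV[R]_d) : Prop :=
  exists b : bool, forall sigma, 0 < (-1) ^+ b * \det (corner_edges v sigma).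

(* Nondegenerate triangles and convex quadrilaterals if d = 2, tetrahedra and  *)
(* parallelepipeds if d = 3.                                                   *)
Definition regular_cell (K : cell d) : Prop :=
  flat_cell K \/
  match K with Simplex _ => False | Cuboid v => d = 2%N /\ convex_cuboid v end.

Definition conforming_mesh (D : set 'rV[R]_d) (T : set (cell d)) : Prop :=
  [/\ finite_set T,
      forall K, T K -> regular_cell K,
      \bigcup_(K in T) cell_set K = closure D &
      forall K K', T K -> T K' -> K <> K' ->
        cell_set K `&` cell_set K' = set0 \/
        exists e, [/\ (e < d)%N,
          is_face K e (cell_set K `&` cell_set K') &
          is_face K' e (cell_set K `&` cell_set K')]].

(* The cells of TG are the (d-1)-dimensional faces of the cells of T lying     *)
(* on the closed interface.                                                    *)
Definition induced_mesh (T : set (cell d)) (TG : set (cell d.-1)) : Prop :=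
  [/\ finite_set TG,
      forall K, TG K -> flat_cell K &
      [set cell_set K | K in TG] =
      [set S | S `<=` closure Gamma /\ exists2 K, T K & is_face K d.-1 S]].

End Cells.

Section Spaces.
Variables (R : realType) (d : nat).

Definition total_degree_le (n k : nat) (p : mpoly.mpoly n R) : Prop :=
  forall m : mpoly.multinom n, mpoly.mcoeff m p != 0 -> (mpoly.mdeg m <= k)%N.

Definition partial_degrees_le (n k : nat) (p : mpoly.mpoly n R) : Prop :=
  forall m : mpoly.multinom n, mpoly.mcoeff m p != 0 ->
  forall i : 'I_n, (mpoly.fun_of_multinom m i <= k)%N.

(* Tensor-product polynomials on a cuboid are taken in its own (reference)     *)
(* coordinates; on a box parallel to the axes these are the polynomials of     *)
(* degree at most k in each Cartesian coordinate.                              *)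
Definition polynomial_on (k n : nat) (K : cell R d n) (f : 'rV[R]_d -> R) :
    Prop :=
  match K with
  | Simplex v => exists2 p : mpoly.mpoly d R, total_degree_le k p &
      forall x, cell_set K x -> f x = mpoly.meval (fun j => x 0 j) p
  | Cuboid v => exists2 p : mpoly.mpoly n R, partial_degrees_le k p &
      forall s, unit_cube s ->
        f (cuboid_map v s) = mpoly.meval (fun j => s 0 j) p
  end.

Definition fe_space (k n : nat) (D Z : set 'rV[R]_d) (T : set (cell R d n)) :
    set ('rV[R]_d -> R) :=
  [set f | [/\ {within closure D, continuous f},
               forall K, T K -> polynomial_on k K f &
               forall x, Z x -> f x = 0]].

Definition U_space (k : nat) (i : 'I_2) (T : set (cell R d d)) :
    set ('rV[R]_d -> R) :=
  fe_space k (Omega i) (boundary_outer i) T.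

Definition UGamma_space (k : nat) (TG : set (cell R d d.-1)) :
    set ('rV[R]_d -> R) :=
  fe_space k Gamma boundary_Gamma TG.

Definition nodal_basis (D : set 'rV[R]_d) (V : set ('rV[R]_d -> R)) (n : nat)
    (phi : 'I_n -> 'rV[R]_d -> R) : Prop :=
  (forall j, V (phi j)) /\
  exists node : 'I_n -> 'rV[R]_d,
    [/\ forall j, closure D (node j),
        forall j l, phi j (node l) = (j == l)%:R &
        forall f, V f -> forall x, closure D x ->
          f x = \sum_j f (node j) * phi j x].

Definition space_time (J : set R) (D : set 'rV[R]_d) (q n : nat)
    (phi : 'I_n -> 'rV[R]_d -> R) : set (R -> 'rV[R]_d -> R) :=
  [set w | exists v : 'I_n -> {poly R},
     (forall j, (size (v j) <= q.+1)%N) /\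
     forall t x, J t -> closure D x -> w t x = \sum_j (v j).[t] * phi j x].

End Spaces.

Section Time.
Variable R : realType.

Definition int_time (J : set R) (h : R -> R) : R :=
  \int[lebesgue_measure]_(t in J) h t.

Definition window (tf : R) (N w : nat) : set R :=
  let dt := tf / N%:R in `]w.-1%:R * dt, w%:R * dt[.

Definition subwindow (tf : R) (N w M n : nat) : set R :=
  let dt := tf / N%:R in
  let t0 := w.-1%:R * dt in
  `]t0 + n.-1%:R * (dt / M%:R), t0 + n%:R * (dt / M%:R)[.

Definition integral_defined (d : nat) (J : set R)
    (g h : R -> 'rV[R]_d -> R) : Prop :=
  {ae lebesgue_measure,
    forall t, J t -> integrable_Gamma (fun x => g t x * h t x)} /\
  (@lebesgue_measure R).-integrable J (fun t => (dot_Gamma (g t) (h t))%:E).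

End Time.

(* Main.v *)
Require Import Defs.
From HB Require Import structures.
From mathcomp Require Import all_boot all_order all_algebra.
From mathcomp Require Import all_classical all_reals all_analysis.
From mathcomp Require Import measurable_realfun ring.

Import Order.TTheory GRing.Theory Num.Theory numFieldNormedType.Exports.

Local Open Scope classical_set_scope.
Local Open Scope ring_scope.

(** Conservation of the discrete fluxes rests on three facts.

    Antisymmetry.  Under the sign conditions on the b_ij and the g_i, the
    integrands on the right of the two flux equations are opposite to each
    other at every point of Gamma and every time of the window.  A test
    function lam of degree at most min(r_1, r_2) in time is admissible in both
    equations, so the integrals of (F_1, lam) and (F_2, lam) are opposite.
    The sign passes from integrands to integrals because the real-valued
    Lebesgue integral is odd on all functions ([RintegralN]).

    Additivity ([int_dot_addl]).  To turn this into a statement about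
    (F_1 + F_2, lam), the integrals have to be split.  This is legitimate since
    at a fixed time the fluxes are continuous on the compact closure of Gamma,
    and since the pairing of two discrete functions is a polynomial in time,
    obtained from their coefficients and the Gram matrix of the basis
    ([dot_Gamma_polynomial]).  This gives the orthogonality claimed for
    r_1 <> r_2.

    Definiteness ([int_dot_self_eq0]).  If r_1 = r_2, the sum S = F_1 + F_2 is
    itself an admissible test function, so the integral of (S, S) vanishes.
    A continuous nonnegative function with zero integral is zero; applying this
    in time and then on Gamma gives S = 0, first on Gamma and then, by
    continuity, on its closure.

    Time and space are treated alike: both integrals are Lebesgue integrals
    pulled back along a parametrization by a finite measure that charges
    nonempty open sets; together with the compactness of the closure of the
    domain, this yields linearity on continuous functions and definiteness.
    For d = 3 this requires that open subsets of the plane be measurable for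
    the product sigma-algebra and of positive product measure if nonempty. *)

(** * Integrals against a finite measure that charges open sets *)

(** X carries no topology: [param_measurable] and [param_charged] only ask that
    preimages of open sets of T behave like open sets for the measure. *)
Record parametrizes {R : realType} {T : topologicalType} (G : set T)
    {dsp : measure_display} {X : measurableType dsp}
    (m : {measure set X -> \bar R}) (D : set X) (e : X -> T) : Prop := {
  param_finite : (m D < +oo)%E ;
  param_image : e @` D = G ;
  param_measurable : forall O, open O -> measurable (D `&` e @^-1` O) ;
  param_charged : forall O, open O -> D `&` e @^-1` O !=set0 ->
    (0 < m (D `&` e @^-1` O))%E }.

(** The parametrization is kept existential so that an interval of times, the
    segment Gamma (d = 2) and the square Gamma (d = 3), which live on different
    measurable spaces, fall under one notion.  Compactness of the closure makes
    every function continuous there bounded, hence integrable. *)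
Definition is_integral_on {R : realType} {T : topologicalType} (G : set T)
    (I : (T -> R) -> R) : Prop :=
  compact (closure G) /\
  exists (dsp : measure_display) (X : measurableType dsp)
         (m : {measure set X -> \bar R}) (D : set X) (e : X -> T),
    parametrizes G m D e /\ forall f, I f = \int[m]_(x in D) f (e x).

Section Continuity.
Context {R : realType} {T : topologicalType}.
Implicit Types (A : set T) (f g : T -> R).

Lemma within_continuous_add A f g :
  {within A, continuous f} -> {within A, continuous g} ->
  {within A, continuous (fun x => f x + g x)}.
Proof. by move=> cf cg x; apply: cvgD; [exact: cf|exact: cg]. Qed.

Lemma within_continuous_mul A f g :
  {within A, continuous f} -> {within A, continuous g} ->
  {within A, continuous (fun x => f x * g x)}.
Proof. by move=> cf cg x; apply: cvgM; [exact: cf|exact: cg]. Qed.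

Lemma within_continuous_cst A (c : R) : {within A, continuous (fun=> c)}.
Proof. by move=> x; exact: cvg_cst. Qed.

Lemma within_continuous_scale A (c : R) f :
  {within A, continuous f} -> {within A, continuous (fun x => c * f x)}.
Proof.
by move=> cf; apply: within_continuous_mul => //; exact: within_continuous_cst.
Qed.

Lemma within_continuous_sum A {J : Type} (s : seq J) (f : J -> T -> R) :
  (forall j, {within A, continuous (f j)}) ->
  {within A, continuous (fun x => \sum_(j <- s) f j x)}.
Proof.
move=> cf; elim: s => [|j s IHs].
  by under eq_fun do rewrite big_nil; exact: within_continuous_cst.
under eq_fun do rewrite big_cons.
exact: within_continuous_add.
Qed.

Lemma continuous_within_eq0_closure A f :
  {within closure A, continuous f} -> (forall x, A x -> f x = 0) ->
  forall x, closure A x -> f x = 0.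
Proof.
move=> /subspace_continuousP cf f0 x Ax; apply/eqP/negPn/negP => fx.
have : nbhs (f x) [set y : R | y != 0].
  exact: (open_nbhs_nbhs (conj (@open_neq R 0) fx)).
move=> /(cf x Ax) /= fxN.
have [y [Ay]] := Ax _ fxN.
by move=> /(_ (subset_closure Ay)) /eqP; apply; exact: f0.
Qed.

End Continuity.

(** The only case where the integral of an extended-real function fails to be
    odd is oo - oo, evaluated as -oo for both signs; [fine] sends it to 0. *)
Lemma RintegralN {R : realType} {dsp : measure_display} {X : measurableType dsp}
    (m : {measure set X -> \bar R}) (D : set X) (f : X -> R) :
  \int[m]_(x in D) (- f x) = - \int[m]_(x in D) f x.
Proof.
rewrite /Rintegral -fineN; set h := fun x => (f x)%:E.
rewrite (_ : (fun x => (- f x)%:E) = \- h)%E; last exact/funext.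
have [dh|] := boolP (\int[m]_(x in D) h^\+ x +?
                     - \int[m]_(x in D) h^\- x)%E.
  by rewrite integralN.
move=> ndh; rewrite [X in fine X = _]integralE.
rewrite [X in _ = fine (- X)%E]integralE funenegN funeposN; move: ndh.
by case: (\int[m]_(x in D) _)%E => [?||]; case: (\int[m]_(x in D) _)%E.
Qed.

Section Parametrization.
Context {R : realType} {T : topologicalType} {G : set T}
  {dsp : measure_display} {X : measurableType dsp}
  {m : {measure set X -> \bar R}} {D : set X} {e : X -> T}.
Hypothesis he : parametrizes G m D e.
Implicit Types f : T -> R.

Lemma parametrizes_mem x : D x -> G (e x).
Proof. by move=> Dx; rewrite -(param_image _ _ _ _ he); exists x. Qed.

Lemma parametrizes_measurable : measurable D.
Proof.
by have := param_measurable _ _ _ _ he _ openT; rewrite preimage_setT setIT.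
Qed.

(** A function continuous on the closure of G need not be continuous on T, but
    an open condition on its values is cut out of G by an open set of T. *)
Lemma parametrizes_preimage_open f :
  {within closure G, continuous f} ->
  forall O : set R, open O -> exists2 V, open V &
    D `&` (f \o e) @^-1` O = D `&` e @^-1` V.
Proof.
move=> /continuousP cf O /cf /open_subspaceP [V oV VE]; exists V => //.
apply/seteqP; split=> x [Dx Ox]; split=> //.
all: have Gx : closure G (e x)
  by apply: subset_closure; exact: parametrizes_mem.
  by have [] : (V `&` closure G) (e x) by rewrite VE.
by have [] : (f @^-1` O `&` closure G) (e x) by rewrite -VE.
Qed.

(** Continuity on a compact set gives a bound, and the measure is finite. *)
Lemma parametrizes_integrable f :
  compact (closure G) -> {within closure G, continuous f} ->
  m.-integrable D (EFin \o (f \o e)).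
Proof.
move=> Gc cf; apply: measurable_bounded_integrable => //.
- exact: parametrizes_measurable.
- exact: param_finite he.
- apply: (measurability _ (RGenOpens.measurableE R)).
  move=> _ [_ [a [b ->] <-]].
  have [V oV ->] := parametrizes_preimage_open _ cf _ (itv_open a b).
  exact: param_measurable he _ oV.
- have /compact_bounded [B [_ Bf]] := continuous_compact cf Gc.
  exists B; split; first exact: num_real.
  move=> y By x /= Dx; apply: (Bf y By); exists (e x) => //.
  by apply: subset_closure; exact: parametrizes_mem.
Qed.

End Parametrization.

Section IntegralOn.
Context {R : realType} {T : topologicalType} {G : set T} {I : (T -> R) -> R}.
Hypothesis hI : is_integral_on G I.
Implicit Types f g : T -> R.

Lemma integral_on_ext f g : (forall x, G x -> f x = g x) -> I f = I g.
Proof.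
case: hI => _ [dsp [X [m [D [e [he IE]]]]]] fg; rewrite !IE.
by apply: eq_Rintegral => x /set_mem Dx; apply/fg/(parametrizes_mem he).
Qed.

Lemma integral_on_opp f : I (fun x => - f x) = - I f.
Proof.
by case: hI => _ [dsp [X [m [D [e [he IE]]]]]]; rewrite !IE RintegralN.
Qed.

Lemma integral_on_add f g :
  {within closure G, continuous f} -> {within closure G, continuous g} ->
  I (fun x => f x + g x) = I f + I g.
Proof.
case: hI => Gc [dsp [X [m [D [e [he IE]]]]]] cf cg.
have mD := parametrizes_measurable he.
have intf := parametrizes_integrable he _ Gc cf.
have intg := parametrizes_integrable he _ Gc cg.
by rewrite !IE RintegralD.
Qed.

Lemma integral_on_scale c f :
  {within closure G, continuous f} -> I (fun x => c * f x) = c * I f.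
Proof.
case: hI => Gc [dsp [X [m [D [e [he IE]]]]]] cf.
have mD := parametrizes_measurable he.
have intf := parametrizes_integrable he _ Gc cf.
by rewrite !IE RintegralZl.
Qed.

Lemma integral_on_lincomb {J : Type} (s : seq J) (c : J -> R)
    (f : J -> T -> R) :
  (forall j, {within closure G, continuous (f j)}) ->
  I (fun x => \sum_(j <- s) c j * f j x) = \sum_(j <- s) c j * I (f j).
Proof.
move=> cf; have cZ j := within_continuous_scale _ (c j) _ (cf j).
elim: s => [|j s IHs].
  under eq_fun do rewrite big_nil.
  rewrite big_nil; have := integral_on_scale 0 _ (within_continuous_cst _ 0).
  by under eq_fun do rewrite mul0r; rewrite mul0r.
under eq_fun do rewrite big_cons.
rewrite integral_on_add ?integral_on_scale ?IHs ?big_cons //.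
exact: within_continuous_sum.
Qed.

(** Definiteness: where f is positive, it is bounded below by a positive
    constant on a relatively open subset of G, which the measure charges.  The
    boundary of G is reached by continuity. *)
Lemma integral_on_eq0 f :
  {within closure G, continuous f} -> (forall x, G x -> 0 <= f x) ->
  I f = 0 -> forall x, closure G x -> f x = 0.
Proof.
case: hI => Gc [dsp [X [m [D [e [he IE]]]]]] cf f0.
rewrite IE => If0; apply: continuous_within_eq0_closure => // z Gz.
have [x0 Dx0 <-] : (e @` D) z by rewrite (param_image _ _ _ _ he).
apply/eqP/negPn/negP => fx0.
have {}fx0 : 0 < f (e x0).
  by rewrite lt_neqAle eq_sym fx0 f0 //; exact: parametrizes_mem he _ _.
(* On the preimage B of the open set where f exceeds half its value at x0, the
   integral of f is at least c times the positive measure of B. *)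
set c := f (e x0) / 2.
have c0 : 0 < c by rewrite divr_gt0.
have mD := parametrizes_measurable he.
have intf := parametrizes_integrable he _ Gc cf.
have [V oV VE] := parametrizes_preimage_open he _ cf _ (@open_gt R c).
set B := D `&` (f \o e) @^-1` _ in VE.
have mB : measurable B by rewrite VE; exact: param_measurable he _ oV.
have BD : B `<=` D by move=> x [].
have B0 : (0 < m B)%E.
  rewrite VE; apply: (param_charged _ _ _ _ he _ oV); rewrite -VE.
  by exists x0; split=> //=; rewrite /c ltr_pdivrMr // ltr_pMr // ltr1n.
have : (c%:E * m B <= \int[m]_(x in D) (f (e x))%:E)%E.
  rewrite -integral_cst //.
  apply: (@le_trans _ _ (\int[m]_(x in B) (f (e x))%:E)%E).
    apply: ge0_le_integral => //.
    - by move=> x _ /=; rewrite lee_fin ltW.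
    - apply: (measurable_funS mD BD).
      by case/integrableP: intf.
    - by move=> x [_ /= /ltW cf_]; rewrite lee_fin.
  apply: ge0_subset_integral => //.
  - by case/integrableP: intf.
  - by move=> x Dx; rewrite lee_fin f0 //; exact: parametrizes_mem he _ _.
have -> : (\int[m]_(x in D) (f (e x))%:E = 0)%E.
  rewrite -[LHS]fineK; first by rewrite [X in X%:E = _]If0.
  exact: integrable_fin_num.
by rewrite leNgt mule_gt0 // lte_fin.
Qed.

End IntegralOn.

(** * The time window and the interface *)

Section OpenSets.
Context {R : realType}.

Lemma lebesgue_open_gt0 (A : set R) : open A -> A !=set0 ->
  (0 < @lebesgue_measure R A)%E.
Proof.
move=> oA [x Ax]; have /nbhs_ballP [r /= r0 rA] := open_nbhs_nbhs (conj oA Ax).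
apply: (@lt_le_trans _ _ (lebesgue_measure (ball x r))).
  by rewrite lebesgue_measure_ball ?ltW // lte_fin mulrn_wgt0.
by apply: le_measure; rewrite ?inE //; apply: open_measurable => //;
  exact: ball_open.
Qed.

(** These boxes form a countable base of the topology of the plane. *)
Definition rat_box (p : (rat * rat) * (rat * rat)) : set (R * R) :=
  `]ratr p.1.1, ratr p.1.2[ `*` `]ratr p.2.1, ratr p.2.2[.

Lemma open_prod_sub_rat (O : set (R * R)) x : open O -> O x ->
  exists p, rat_box p x /\ rat_box p `<=` O.
Proof.
move=> oO Ox; have /nbhs_ballP [r /= r0 rO] := open_nbhs_nbhs (conj oO Ox).
have rat_nbhd (y : R) : exists a b : rat,
    ratr a < y < ratr b /\ forall z, ratr a < z < ratr b -> ball y r z.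
  have [|a] := @rat_in_itvoo R (y - r) y; first by rewrite ltrBlDr ltrDl.
  have [|b] := @rat_in_itvoo R y (y + r); first by rewrite ltrDl.
  rewrite !in_itv /= => /andP[yb br] /andP[ra ay]; exists a, b; split.
    by rewrite ay yb.
  move=> z /andP[az zb]; rewrite ball_itv /= in_itv /=.
  by rewrite (lt_trans ra az) (lt_trans zb br).
have [a [b [x1 ab]]] := rat_nbhd x.1.
have [c [d [x2 cd]]] := rat_nbhd x.2.
exists ((a, b), (c, d)); split.
  by split; rewrite /= in_itv.
move=> z [/=]; rewrite !in_itv /= => z1 z2; apply: rO; split.
  exact: ab.
exact: cd.
Qed.

(** The Borel sigma-algebra of the plane is contained in the product one, since
    an open set is the union of the countably many rational boxes inside it. *)
Lemma open_prod_measurable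
    (O : set (measurableTypeR R * measurableTypeR R)%type) :
  open (O : set (R * R)) -> measurable O.
Proof.
move=> oO.
have -> : O = \bigcup_p (if `[< rat_box p `<=` O >] then rat_box p else set0).
  apply/seteqP; split=> [x Ox|x [p _]].
    have [p [Bx BO]] := open_prod_sub_rat _ _ oO Ox.
    by exists p => //; rewrite ifT //; apply/asboolP.
  by case: ifPn => [/asboolP BO|//]; exact: BO.
apply: countable_bigcupT_measurable => [|p]; first exact: countableP.
case: ifPn => // _.
apply: measurableX; exact: measurable_itv.
Qed.

Lemma lebesgue_prod_open_gt0
    (O : set (measurableTypeR R * measurableTypeR R)%type) :
  open (O : set (R * R)) -> O !=set0 ->
  (0 < (@lebesgue_measure R \x @lebesgue_measure R) O)%E.
Proof.
move=> oO [x Ox]; have [p /= [[x1 x2] BO]] := open_prod_sub_rat _ _ oO Ox.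
apply: (@lt_le_trans _ _ ((@lebesgue_measure R \x @lebesgue_measure R)
  (rat_box p))%E).
  rewrite product_measure1E //; try exact: measurable_itv.
  by apply: mule_gt0; apply: lebesgue_open_gt0;
    [exact: itv_open|exists x.1|exact: itv_open|exists x.2].
apply: le_measure => //; rewrite inE; last exact: open_prod_measurable.
by apply: measurableX; exact: measurable_itv.
Qed.

End OpenSets.

Section Instances.
Context {R : realType}.

Lemma int_time_integral_on (a b : R) :
  is_integral_on `]a, b[%classic (@int_time R `]a, b[%classic).
Proof.
split.
  apply: (@subclosed_compact R _ `[a, b]%classic).
  - exact: closed_closure.
  - exact: segment_compact.
  - exact: itv_closure.
exists _, _, (@lebesgue_measure R), `]a, b[%classic, id; split=> //; split.
- by rewrite /= lebesgue_measure_itv /=; case: ifP; rewrite ?ltry.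
- by rewrite image_id.
- move=> O oO; apply: open_measurable; exact: openI.
- by move=> O oO; apply: lebesgue_open_gt0; exact: openI.
Qed.

Lemma continuous_row_of_seq {d : nat} {X : topologicalType} (s : X -> seq R) :
  (forall j, continuous (fun y => (s y)`_j)) ->
  continuous (fun y => row_of_seq (s y) : 'rV[R]_d).
Proof.
move=> cs y A [P yP PA]; apply: filterS PA _.
apply: filter_forall => i; apply: filter_forall => j.
have := yP i j; rewrite mxE => /(cs j y) Pj.
by apply: (@filterS _ (nbhs y) _ _ _ _ Pj) => z; rewrite /row_of_seq /= mxE.
Qed.

Lemma closure_Gamma_compact (d : nat) : compact (closure (@Gamma R d)).
Proof.
have cC : compact [set v : 'rV[R]_d | forall i, `[0, 1]%classic (v ord0 i)].
  apply: (@rV_compact R d (fun=> `[0, 1]%classic)) => i.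
  exact: segment_compact.
apply: (@subclosed_compact _ _ _ _ cC); first exact: closed_closure.
have cC' := compact_closed (@norm_hausdorff _ _) cC.
rewrite [X in _ `<=` X](closure_id _).1 //; apply: closureS => x Gx i /=.
rewrite in_itv /=; move: (Gx i); case: ifP => _.
  by move=> /andP[x0 x1]; rewrite !ltW.
by move=> /eqP ->; rewrite lexx ler01.
Qed.

Lemma Gamma_row_of_seq (n : nat) (s : seq R) : size s = n ->
  (forall j, (j < n)%N -> 0 < s`_j < 1) ->
  Gamma (row_of_seq s : 'rV[R]_n.+1).
Proof.
move=> ns s01 j; rewrite /row_of_seq mxE ltnS.
by case: ltnP => jn; [exact: s01|rewrite nth_default ?ns].
Qed.

Lemma Gamma_row_of_coordinates (n : nat) (x : 'rV[R]_n.+1) : Gamma x ->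
  x = row_of_seq (mkseq (fun j => x 0 (inord j)) n).
Proof.
move=> Gx; apply/rowP => j; rewrite mxE; have := Gx j; rewrite ltnS.
case: ltnP => jn; first by rewrite nth_mkseq // inord_val.
by move=> /eqP ->; rewrite nth_default ?size_mkseq.
Qed.

Lemma Gamma_coordinate (n : nat) (x : 'rV[R]_n.+1) (j : nat) : Gamma x ->
  (j < n)%N -> 0 < x 0 (inord j) < 1.
Proof.
move=> Gx jn; have := Gx (inord j).
by rewrite inordK ltnS ?(ltnW jn) // jn.
Qed.

(** The parametrization y |-> (y, 0) is continuous on the open interval or
    square, so preimages of open sets are open there and inherit measurability
    and positive measure. *)
Lemma int_Gamma_integral_on (d : nat) : d = 2%N \/ d = 3%N ->
  is_integral_on (@Gamma R d) int_Gamma.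
Proof.
case=> ->; (split; first exact: closure_Gamma_compact).
- pose e (y : R) : 'rV[R]_2 := row_of_seq [:: y].
  exists _, _, (@lebesgue_measure R), `]0, 1[%classic, e; split; last by [].
  have ce : continuous e.
    apply: continuous_row_of_seq; case=> [|j] y; first exact: cvg_id.
    by rewrite /= nth_nil; exact: cvg_cst.
  have oD O : open O -> open (`]0, 1[ `&` e @^-1` O).
    by move=> oO; apply: openI; [exact: itv_open|exact: (continuousP _).1].
  split.
  + by rewrite /= lebesgue_measure_itv /= lte01 ltry.
  + apply/seteqP; split=> [_ [y y01 <-]|x Gx].
      by apply: Gamma_row_of_seq => // -[].
    by exists (x 0 (inord 0)); [exact: Gamma_coordinate
                               |rewrite [RHS]Gamma_row_of_coordinates].
  + by move=> O /oD; exact: open_measurable.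
  + by move=> O /oD; exact: lebesgue_open_gt0.
- pose e (y : R * R) : 'rV[R]_3 := row_of_seq [:: y.1; y.2].
  exists _, _, (@lebesgue_measure R \x @lebesgue_measure R)%E,
    (`]0, 1[ `*` `]0, 1[), e; split; last by [].
  have ce : continuous e.
    apply: continuous_row_of_seq; case=> [|[|j]] y.
    - exact: cvg_fst.
    - exact: cvg_snd.
    - by rewrite /= nth_nil; exact: cvg_cst.
  have oD O : open O -> open ((`]0, 1[ `*` `]0, 1[) `&` e @^-1` O).
    move=> oO; apply: openI; last exact: (continuousP _).1.
    have o1 : open ((fst : R * R -> R) @^-1` `]0, 1[%classic).
      by apply: (continuousP _).1 => [y|]; [exact: cvg_fst|exact: itv_open].
    have o2 : open ((snd : R * R -> R) @^-1` `]0, 1[%classic).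
      by apply: (continuousP _).1 => [y|]; [exact: cvg_snd|exact: itv_open].
    exact: openI o1 o2.
  split.
  + rewrite [ltLHS]product_measure1E; try exact: measurable_itv.
    by rewrite /= lebesgue_measure_itv /= lte01 oppr0 adde0 mule1 ltry.
  + apply/seteqP; split=> [_ [y [y1 y2] <-]|x Gx].
      by apply: Gamma_row_of_seq => // -[|[]].
    exists (x 0 (inord 0), x 0 (inord 1)).
      by split; exact: Gamma_coordinate.
    by rewrite [RHS]Gamma_row_of_coordinates.
  + by move=> O /oD; exact: open_prod_measurable.
  + by move=> O /oD; exact: lebesgue_prod_open_gt0.
Qed.

End Instances.

(** * Pairings of discrete space-time functions *)

Section SpaceTime.
Context {R : realType} {d n : nat} {J : set R} {mu : 'I_n -> 'rV[R]_d -> R}.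
Implicit Types (F lam S : R -> 'rV[R]_d -> R).

Lemma space_time_le {D : set 'rV[R]_d} {q q' : nat} {F} : (q <= q')%N ->
  space_time J D q mu F -> space_time J D q' mu F.
Proof.
move=> qq' [v [sv Fv]]; exists v; split=> // j.
by rewrite (leq_trans (sv j)).
Qed.

Lemma space_time_add {D : set 'rV[R]_d} {q : nat} {F1 F2} :
  space_time J D q mu F1 -> space_time J D q mu F2 ->
  space_time J D q mu (fun t x => F1 t x + F2 t x).
Proof.
move=> [v1 [s1 E1]] [v2 [s2 E2]]; exists (fun j => v1 j + v2 j).
split=> [j|t x Jt Dx].
  by rewrite (leq_trans (size_polyD _ _)) // geq_max s1 s2.
rewrite E1 // E2 // -big_split /=; apply: eq_bigr => j _.
by rewrite hornerD mulrDl.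
Qed.

Hypothesis mu_cont : forall j, {within closure Gamma, continuous (mu j)}.

Lemma space_time_continuous {q : nat} {F t} :
  space_time J Gamma q mu F -> J t -> {within closure Gamma, continuous (F t)}.
Proof.
move=> [v [_ E]] Jt.
apply: (@subspace_eq_continuous _ _ _ (fun x => \sum_j (v j).[t] * mu j x)).
  by move=> x /set_mem Gx; apply/esym/E.
apply: within_continuous_sum => j.
exact: within_continuous_scale.
Qed.

Hypothesis hI : is_integral_on (@Gamma R d) int_Gamma.

Lemma dot_Gamma_addl {q1 q2 s : nat} {F1 F2 lam t} :
  space_time J Gamma q1 mu F1 -> space_time J Gamma q2 mu F2 ->
  space_time J Gamma s mu lam -> J t ->
  dot_Gamma (fun x => F1 t x + F2 t x) (lam t) =
  dot_Gamma (F1 t) (lam t) + dot_Gamma (F2 t) (lam t).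
Proof.
move=> h1 h2 hl Jt; rewrite -(integral_on_add hI).
- by congr int_Gamma; apply/funext => x; rewrite mulrDl.
- by apply: within_continuous_mul; apply: space_time_continuous; eassumption.
- by apply: within_continuous_mul; apply: space_time_continuous; eassumption.
Qed.

(** The coefficients of F and lam on the basis are polynomials in time, so
    expanding the pairing over the Gram matrix of the basis gives a polynomial;
    this makes all time integrals below integrals of continuous functions. *)
Lemma dot_Gamma_polynomial {q s : nat} {F lam} :
  space_time J Gamma q mu F -> space_time J Gamma s mu lam ->
  exists p : {poly R}, forall t, J t -> dot_Gamma (F t) (lam t) = p.[t].
Proof.
move=> [v [_ Fv]] [w [_ lw]].
exists (\sum_j v j * \sum_l w l * (dot_Gamma (mu j) (mu l))%:P) => t Jt.
transitivity (int_Gamma (fun x : 'rV[R]_d =>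
    \sum_j (v j).[t] * (mu j x * \sum_l (w l).[t] * mu l x))).
  apply: (integral_on_ext hI) => x /subset_closure Gx.
  by rewrite Fv // lw // mulr_suml; apply: eq_bigr => j _; rewrite mulrA.
rewrite (integral_on_lincomb hI) => [|j]; last first.
  apply: within_continuous_mul => //; apply: within_continuous_sum => l.
  exact: within_continuous_scale.
rewrite horner_sum; apply: eq_bigr => j _; rewrite hornerM horner_sum.
congr (_ * _); transitivity (int_Gamma (fun x : 'rV[R]_d =>
    \sum_l (w l).[t] * (mu j x * mu l x))).
  congr int_Gamma; apply/funext => x; rewrite mulr_sumr.
  by apply: eq_bigr => l _; rewrite mulrCA.
rewrite (integral_on_lincomb hI) => [|l]; last exact: within_continuous_mul.
by apply: eq_bigr => l _; rewrite hornerM hornerC.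
Qed.

Hypothesis hJ : is_integral_on J (int_time J).

Lemma int_dot_addl {q1 q2 s : nat} {F1 F2 lam} :
  space_time J Gamma q1 mu F1 -> space_time J Gamma q2 mu F2 ->
  space_time J Gamma s mu lam ->
  int_time J (fun t => dot_Gamma (fun x => F1 t x + F2 t x) (lam t)) =
  int_time J (fun t => dot_Gamma (F1 t) (lam t)) +
  int_time J (fun t => dot_Gamma (F2 t) (lam t)).
Proof.
move=> h1 h2 hl.
have [p1 E1] := dot_Gamma_polynomial h1 hl.
have [p2 E2] := dot_Gamma_polynomial h2 hl.
rewrite (integral_on_ext hJ _ _ E1) (integral_on_ext hJ _ _ E2).
rewrite -(integral_on_add hJ); try exact/continuous_subspaceT/continuous_horner.
apply: (integral_on_ext hJ) => t Jt.
by rewrite (dot_Gamma_addl h1 h2 hl Jt) E1 ?E2.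
Qed.

(** Definiteness is applied twice: to the polynomial t |-> (S t, S t) on the
    window, then at each time to the square of S t on the interface. *)
Lemma int_dot_self_eq0 {q : nat} {S} : space_time J Gamma q mu S ->
  int_time J (fun t => dot_Gamma (S t) (S t)) = 0 ->
  forall t x, J t -> closure Gamma x -> S t x = 0.
Proof.
move=> hS S0 t x Jt Gx.
have [p Ep] := dot_Gamma_polynomial hS hS.
have dot_ge0 u : 0 <= dot_Gamma (S u) (S u).
  case: hI => _ [? [? [m [D [e [_ IE]]]]]].
  by rewrite /dot_Gamma IE; apply: Rintegral_ge0 => y _; exact: sqr_ge0.
have dot0 : dot_Gamma (S t) (S t) = 0.
  rewrite Ep //; apply: (integral_on_eq0 hJ) => //.
  - exact/continuous_subspaceT/continuous_horner.
  - by move=> u Ju; rewrite -Ep.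
  - by rewrite -[RHS]S0; apply: (integral_on_ext hJ) => u Ju; rewrite -Ep.
  - exact: subset_closure.
have cS := space_time_continuous hS Jt.
apply/eqP; rewrite -sqrf_eq0 expr2; apply/eqP; move: x Gx.
apply: (integral_on_eq0 hI) => //; first exact: within_continuous_mul.
by move=> x _; exact: sqr_ge0.
Qed.

End SpaceTime.

(** * Flux conservation *)

Lemma window_time_bounds {R : realType} (tf : R) (N w : nat) (t : R) : 0 < tf ->
  (1 <= w <= N)%N -> window tf N w t -> 0 < t <= tf.
Proof.
move=> tf0 /andP[w1 wN]; rewrite /window /= in_itv /= => /andP[t1 t2].
have N0 : 0 < N%:R :> R by rewrite ltr0n (leq_trans w1).
apply/andP; split.
  by apply: le_lt_trans t1; rewrite mulr_ge0 // divr_ge0 // ltW.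
apply: le_trans (ltW t2) _; rewrite mulrCA ger_pMr //.
by rewrite ler_pdivrMr // mul1r ler_nat.
Qed.

Theorem theorem1 (R : realType) (d : nat) (hd : d = 2%N \/ d = 3%N)
  (* meshes, finite element spaces and nodal bases *)
  (tau : 'I_2 -> set (cell R d d)) (tauG : set (cell R d d.-1))
  (htau : forall i, conforming_mesh (Omega i) (tau i))
  (htauG : forall i, induced_mesh (tau i) tauG)
  (k : nat) (hk : (1 <= k)%N)
  (dO : 'I_2 -> nat) (phi : forall i : 'I_2, 'I_(dO i) -> 'rV[R]_d -> R)
  (hphi : forall i, nodal_basis (Omega i) (U_space k i (tau i)) (phi i))
  (dG : nat) (mu : 'I_dG -> 'rV[R]_d -> R)
  (hmu : nodal_basis Gamma (UGamma_space k tauG) mu)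
  (* time discretization, and the coupling window w *)
  (tf : R) (htf : 0 < tf) (N : nat) (hN : (1 <= N)%N)
  (M : 'I_2 -> nat) (hM : forall i, (1 <= M i)%N)
  (q : nat) (r : 'I_2 -> nat)
  (w : nat) (hw : (1 <= w <= N)%N)
  (* coefficients and interfacial forcings *)
  (b : 'I_2 -> 'I_2 -> R) (g : 'I_2 -> R -> 'rV[R]_d -> R)
  (hg : forall i lam, space_time (window tf N w) Gamma (r i) mu lam ->
     integral_defined (window tf N w) (g i) lam)
  (hb1 : b ord0 ord0 = - b ord_max ord0)
  (hb2 : b ord0 ord_max = - b ord_max ord_max)
  (hg12 : forall (t : R) (x : 'rV[R]_d), 0 < t <= tf -> Gamma x -> g ord0 t x = - g ord_max t x)
  (* states, auxiliary traces and fluxes on the window *)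
  (u : 'I_2 -> nat -> R -> 'rV[R]_d -> R)
  (hu : forall i n, (1 <= n <= M i)%N ->
     space_time (subwindow tf N w (M i) n) (Omega i) q (phi i) (u i n))
  (uG : 'I_2 -> R -> 'rV[R]_d -> R)
  (huG : forall i, space_time (window tf N w) Gamma (r i) mu (uG i))
  (F : 'I_2 -> R -> 'rV[R]_d -> R)
  (hF : forall i, space_time (window tf N w) Gamma (r i) mu (F i))
  (trace_eq : forall i lam, space_time (window tf N w) Gamma (r i) mu lam ->
     int_time (window tf N w) (fun t => dot_Gamma (uG i t) (lam t)) =
     \sum_(1 <= n < (M i).+1)
       int_time (subwindow tf N w (M i) n)
         (fun t => dot_Gamma (u i n t) (lam t)))
  (flux_eq : forall i lam, space_time (window tf N w) Gamma (r i) mu lam ->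
     int_time (window tf N w) (fun t => dot_Gamma (F i t) (lam t)) =
     int_time (window tf N w) (fun t =>
       dot_Gamma (fun x => b i ord0 * uG ord0 t x + b i ord_max * uG ord_max t x
                           - g i t x) (lam t))) :
  (r ord0 = r ord_max ->
     forall (t : R) (x : 'rV[R]_d), window tf N w t -> closure Gamma x ->
       F ord0 t x + F ord_max t x = 0) /\
  (r ord0 <> r ord_max ->
     forall lam,
       space_time (window tf N w) Gamma (minn (r ord0) (r ord_max)) mu lam ->
       int_time (window tf N w) (fun t =>
         dot_Gamma (fun x => F ord0 t x + F ord_max t x) (lam t)) = 0).
Proof.
set J := window tf N w in hg trace_eq flux_eq huG hF *.
have hI : is_integral_on (@Gamma R d) int_Gamma by exact: int_Gamma_integral_on.
have hJ : is_integral_on J (int_time J) by exact: int_time_integral_on.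
have mu_cont j : {within closure Gamma, continuous (mu j)}.
  by case: hmu => /(_ j) [].
(* With the minimal degree, lam is admissible in both flux equations, whose
   right-hand sides have pointwise opposite integrands. *)
have flux_opp lam : space_time J Gamma (minn (r ord0) (r ord_max)) mu lam ->
    int_time J (fun t => dot_Gamma (F ord0 t) (lam t)) =
    - int_time J (fun t => dot_Gamma (F ord_max t) (lam t)).
  move=> hlam.
  rewrite flux_eq; last exact: space_time_le (geq_minl _ _) hlam.
  rewrite flux_eq; last exact: space_time_le (geq_minr _ _) hlam.
  rewrite -(integral_on_opp hJ); apply: (integral_on_ext hJ) => t Jt.
  rewrite -(integral_on_opp hI); apply: (integral_on_ext hI) => x Gx.
  rewrite hb1 hb2 hg12 //; last exact: window_time_bounds Jt.
  ring.
have sum_orth lam : space_time J Gamma (minn (r ord0) (r ord_max)) mu lam ->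
    int_time J (fun t =>
      dot_Gamma (fun x => F ord0 t x + F ord_max t x) (lam t)) = 0.
  move=> hlam; rewrite (int_dot_addl mu_cont hI hJ (hF ord0) (hF ord_max) hlam).
  by rewrite flux_opp // addNr.
split=> [r12 t x Jt Gx|_]; last exact: sum_orth.
(* For equal degrees the flux sum is itself an admissible test function. *)
have hS : space_time J Gamma (r ord0) mu
    (fun t x => F ord0 t x + F ord_max t x).
  by apply: space_time_add => //; rewrite r12.
apply: (int_dot_self_eq0 mu_cont hI hJ hS) => //.
by apply: sum_orth; rewrite -r12 minnn.
Qed.
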